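(* Let $T$ be a theory with JCP, $\mathfrak M$ a monster model of $T$, and $\mathcal E$ a set of type-definable equivalence relations. Then the structure $\mathfrak M^{\mathcal E}$ is a monster model of the $\mathcal L_{\mathcal E}$-theory $T^{\mathcal E}$ (with respect to the same notion of smallness as $\mathfrak M$).
   Context: Positive logic: formulas are built from atomic formulas with $\top,\bot,\wedge,\vee,\exists$; a theory is a consistent set of h-inductive sentences $\forall x(\phi\to\psi)$ with $\phi,\psi$ positive; a model $M$ of $T$ is p.c. if every homomorphism (map preserving positive formulas) from $M$ into a model of $T$ also reflects positive formulas; JCP means any two models map homomorphically into a common model. Given a notion of ''small'', a monster model of a JCP theory is a p.c. model in which every small set of positive formulas with parameters that is finitely satisfiable is satisfiable, and in which any two small tuples with the same set of satisfied positive formulas are conjugate by an automorphism. Let $\mathcal L$ be the signature of $T$. A type-definable equivalence relation is a set $E(x,y)$ of positive $\mathcal L$-formulas without parameters, $x,y$ small tuples of variables of matching sorts, defining an equivalence relation on $\mathfrak M$. The signature $\mathcal L_{\mathcal E}$ extends $\mathcal L$ (whose sorts are called real) by a new sort $S_E$ for each $E\in\mathcal E$ and, for each finite tuple of variables $x$ of real and/or new sorts and each $\mathcal L$-formula $\phi(x_r)$, a relation symbol $R_\phi(x)$; here $x_r$ is obtained from $x$ by replacing each variable of sort $S_E$ with a tuple of real variables of the sorts of the variables of $E$ (only finitely many actually occur in $\phi$). The $\mathcal L_{\mathcal E}$-structure $\mathfrak M^{\mathcal E}$ expands $\mathfrak M$ by interpreting $S_E$ as the set of $E$-classes of $\mathfrak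 M$ and setting $\mathfrak M^{\mathcal E}\models R_\phi(c)$ iff there is a tuple $b$ in $\mathfrak M$ representing $c$ (each real entry represented by itself, each class by one of its members) with $\mathfrak M\models\phi(b)$. $T^{\mathcal E}$ is the set of h-inductive $\mathcal L_{\mathcal E}$-sentences true in $\mathfrak M^{\mathcal E}$.
   Formalization: The signature of T is assumed to be small, and ''small'' is read as ''of cardinality below an uncountable regular cardinal''; without a small signature, homogeneity of the structure with hyperimaginary sorts can fail. *)

(* Defs.v *)
(** Many-sorted positive logic, over MathComp.  Sorts of a structure are allowed
    to be empty: a theory excludes this by containing the axioms [exists x, T]. *)
From mathcomp Require Import all_boot.
From Stdlib Require Import RelationClasses.

Set Implicit Arguments.
Unset Strict Implicit.
Unset Printing Implicit Defensive.

(** [small A] plays the role of "|A| < kappa" for an uncountable regular kappa. *)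
Record smallness := Smallness {
  small :> Type -> Prop;
  small_nat : small nat;
  small_inj : forall (A B : Type) (f : A -> B), injective f -> small B -> small A;
  small_sigma : forall (A : Type) (B : A -> Type),
    small A -> (forall a, small (B a)) -> small {a : A & B a} }.

Record signature := Signature {
  sort : Type;
  fsym : Type;
  farity : fsym -> nat;
  fdom : forall f, 'I_(farity f) -> sort;
  fcod : fsym -> sort;
  rsym : Type;
  rarity : rsym -> nat;
  rdom : forall r, 'I_(rarity r) -> sort }.

Definition small_signature (sm : smallness) (L : signature) : Prop :=
  [/\ sm (sort L), sm (fsym L) & sm (rsym L)].

(** A tuple of sorted variables, possibly infinite. *)
Record ctx (S : Type) := Ctx { var : Type; srt : var -> S }.
Arguments Ctx {S var} srt.

Definition ctx_ext S (X : ctx S) (s : S) : ctx S :=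
  Ctx (fun o : option (var X) => if o is Some x then srt x else s).

Definition ctx_sum S (X Y : ctx S) : ctx S :=
  Ctx (fun z : var X + var Y =>
         match z with inl x => srt x | inr y => srt y end).

Inductive term (L : signature) (X : ctx (sort L)) : sort L -> Type :=
| Var (x : var X) : term X (srt x)
| App (f : fsym L) (t : forall i, term X (fdom (f := f) i)) : term X (fcod f).

(** Positive formulas with free variables among [X].  The bound variable of [Ex]
    is [None]. *)
Inductive formula (L : signature) (X : ctx (sort L)) : Type :=
| Eq (s : sort L) (t u : term X s)
| Rel (r : rsym L) (t : forall i, term X (rdom (r := r) i))
| Top
| Bot
| And (phi psi : formula X)
| Or (phi psi : formula X)
| Ex (s : sort L) (phi : formula (ctx_ext X s)).

Record structure (L : signature) := Structure {
  carrier :> sort L -> Type;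
  fint : forall f : fsym L,
    (forall i, carrier (fdom (f := f) i)) -> carrier (fcod f);
  rint : forall r : rsym L, (forall i, carrier (rdom (r := r) i)) -> Prop }.

Definition assignment S (M : S -> Type) (X : ctx S) : Type :=
  forall x : var X, M (srt x).

Definition assign_ext S (M : S -> Type) (X : ctx S) (a : assignment M X) (s : S)
    (m : M s) : assignment M (ctx_ext X s) :=
  fun o => match o return M (srt (c := ctx_ext X s) o) with
           | Some x => a x
           | None => m
           end.

Definition assign_sum S (M : S -> Type) (X Y : ctx S) (a : assignment M X)
    (b : assignment M Y) : assignment M (ctx_sum X Y) :=
  fun z => match z return M (srt (c := ctx_sum X Y) z) with
           | inl x => a x
           | inr y => b y
           end.

Fixpoint eval L (M : structure L) (X : ctx (sort L)) (a : assignment M X)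
    (s : sort L) (t : term X s) : M s :=
  match t with
  | Var x => a x
  | App f t => fint (fun i => eval a (t i))
  end.

Fixpoint sat L (M : structure L) (X : ctx (sort L)) (phi : formula X) :
    assignment M X -> Prop :=
  match phi with
  | Eq _ t u => fun a => eval a t = eval a u
  | Rel r t => fun a => rint (fun i => eval a (t i))
  | Top => fun _ => True
  | Bot => fun _ => False
  | And phi psi => fun a => sat phi a /\ sat psi a
  | Or phi psi => fun a => sat phi a \/ sat psi a
  | Ex s phi => fun a => exists m : M s, sat phi (assign_ext a m)
  end.

(** The sentence [forall x, phi -> psi], with [x] a finite tuple. *)
Record hsentence (L : signature) := HSentence {
  hs_len : nat;
  hs_srt : 'I_hs_len -> sort L;
  hs_prem : formula (Ctx hs_srt);
  hs_concl : formula (Ctx hs_srt) }.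

Definition holds L (M : structure L) (chi : hsentence L) : Prop :=
  forall a : assignment M (Ctx (hs_srt (h := chi))),
    sat (hs_prem chi) a -> sat (hs_concl chi) a.

Record theory (L : signature) := Theory {
  axioms :> hsentence L -> Prop;
  consistent : exists M : structure L, forall chi, axioms chi -> holds M chi }.

Definition model L (T : theory L) (M : structure L) : Prop :=
  forall chi, T chi -> holds M chi.

Definition homomorphism L (M N : structure L) (h : forall s, M s -> N s) : Prop :=
  forall (X : ctx (sort L)) (phi : formula X) (a : assignment M X),
    sat phi a -> sat phi (fun x => h _ (a x)).

Definition reflects L (M N : structure L) (h : forall s, M s -> N s) : Prop :=
  forall (X : ctx (sort L)) (phi : formula X) (a : assignment M X),
    sat phi (fun x => h _ (a x)) -> sat phi a.

Definition automorphism L (M : structure L) (sigma : forall s, M s -> M s) : Prop :=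
  homomorphism sigma /\
  exists tau : forall s, M s -> M s,
    [/\ homomorphism tau,
        forall s, cancel (sigma s) (tau s) & forall s, cancel (tau s) (sigma s)].

Definition pc_model L (T : theory L) (M : structure L) : Prop :=
  model T M /\
  forall (N : structure L) (h : forall s, M s -> N s),
    model T N -> homomorphism h -> reflects h.

Definition JCP L (T : theory L) : Prop :=
  forall M N : structure L, model T M -> model T N ->
  exists (K : structure L) (f : forall s, M s -> K s) (g : forall s, N s -> K s),
    [/\ model T K, homomorphism f & homomorphism g].

(** One variable for each element of [M], used as a name for that element. *)
Definition params L (M : structure L) : ctx (sort L) :=
  Ctx (fun p : {s : sort L & M s} => tag p).

Definition sat_params L (M : structure L) (X : ctx (sort L))
    (phi : formula (ctx_sum X (params M))) (a : assignment M X) : Prop :=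
  sat phi (assign_sum (Y := params M) a (fun p => tagged p)).

Definition small_saturated (sm : smallness) L (M : structure L) : Prop :=
  forall (X : ctx (sort L)) (Phi : formula (ctx_sum X (params M)) -> Prop),
    sm {phi | Phi phi} ->
    (forall (n : nat) (phi : 'I_n -> formula (ctx_sum X (params M))),
       (forall i, Phi (phi i)) ->
       exists a : assignment M X, forall i, sat_params (phi i) a) ->
    exists a : assignment M X, forall phi, Phi phi -> sat_params phi a.

Definition small_homogeneous (sm : smallness) L (M : structure L) : Prop :=
  forall (X : ctx (sort L)) (a b : assignment M X),
    sm (var X) ->
    (forall phi : formula X, sat phi a <-> sat phi b) ->
    exists2 sigma : forall s, M s -> M s,
      automorphism sigma & forall x, sigma _ (a x) = b x.

(** Monster models are only defined for theories with JCP. *)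
Record monster (sm : smallness) L (T : theory L) (M : structure L) : Prop := {
  monster_jcp : JCP T;
  monster_pc : pc_model T M;
  monster_saturated : small_saturated sm M;
  monster_homogeneous : small_homogeneous sm M }.

Definition typedef_rel L (M : structure L) (X : ctx (sort L))
    (E : formula (ctx_sum X X) -> Prop) (a b : assignment M X) : Prop :=
  forall phi, E phi -> sat phi (assign_sum a b).

Record typedef_equiv (sm : smallness) L (M : structure L) := TypedefEquiv {
  te_ctx : ctx (sort L);
  te_small : sm (var te_ctx);
  te_fml : formula (ctx_sum te_ctx te_ctx) -> Prop;
  te_equiv : Equivalence (@typedef_rel L M te_ctx te_fml) }.

(** [calE] is a set of type-definable equivalence relations, as an indexed family:
    the relations themselves live in a universe too large for indexing sorts. *)
Section Hyperimaginaries.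
Variables (sm : smallness) (L : signature) (M : structure L).
Variables (I : Type) (calE : I -> typedef_equiv sm M).

Definition hsort : Type := (sort L + I)%type.

Definition real_ctx1 (s : hsort) : ctx (sort L) :=
  match s with
  | inl s0 => Ctx (fun _ : unit => s0)
  | inr e => te_ctx (calE e)
  end.

(** The tuple x_r of real variables obtained from a finite tuple x. *)
Definition real_ctx (n : nat) (s : 'I_n -> hsort) : ctx (sort L) :=
  Ctx (fun p : {i : 'I_n & var (real_ctx1 (s i))} => srt (tagged p)).

(** The symbols R_phi(x). *)
Record hrel := HRel {
  hr_len : nat;
  hr_srt : 'I_hr_len -> hsort;
  hr_fml : formula (real_ctx hr_srt) }.

Definition hsignature : signature :=
  @Signature hsort
    (fsym L) (@farity L) (fun f i => inl (fdom (f := f) i)) (fun f => inl (fcod f))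
    (rsym L + hrel)%type
    (fun r => match r with inl r0 => rarity r0 | inr r1 => hr_len r1 end)
    (fun r => match r with
              | inl r0 => fun i => inl (rdom (r := r0) i)
              | inr r1 => hr_srt (h := r1)
              end).

Definition eq_class (e : I) : Type :=
  {C : assignment M (te_ctx (calE e)) -> Prop |
    exists a, C = typedef_rel (te_fml (t := calE e)) a}.

Definition hcarrier (s : hsort) : Type :=
  match s with
  | inl s0 => M s0
  | inr e => eq_class e
  end.

Definition represents1 (s : hsort) :
    assignment M (real_ctx1 s) -> hcarrier s -> Prop :=
  match s with
  | inl s0 => fun b c => b tt = c
  | inr e => fun b c => sval c b
  end.

Definition represents (n : nat) (s : 'I_n -> hsort)
    (b : assignment M (real_ctx s)) (c : forall i, hcarrier (s i)) : Prop :=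
  forall i, represents1 (s := s i)
    (fun x => b (existT (fun j => var (real_ctx1 (s j))) i x)) (c i).

Definition hstructure : structure hsignature :=
  @Structure hsignature hcarrier
    (fun f => @fint L M f)
    (fun r => match r with
              | inl r0 => @rint L M r0
              | inr r1 => fun c =>
                  exists2 b, represents b c & sat (hr_fml r1) b
              end).

Lemma htheory_consistent :
  exists N : structure hsignature,
    forall chi, holds hstructure chi -> holds N chi.
Proof. by exists hstructure. Qed.

Definition htheory : theory hsignature := Theory htheory_consistent.

End Hyperimaginaries.

(* Main.v *)
(** Everything reduces to type-definable sets of [M].  By saturation these are
    closed under projection, so the preimage under the class map of any positively
    definable set of the structure with hyperimaginary sorts is type-definable in
    [M]; saturation is then inherited from [M].  The symbols [R_psi] express
    conversely that some representative satisfies [psi].  If a tuple fails a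
    positive formula [phi], one of its representatives fails a member [psi] of the
    partial type of [phi]; since [M] is positively closed, it satisfies some
    [theta] incompatible with [psi], and then [R_theta] refutes [phi], which gives
    positive closedness.  For homogeneity, saturation yields representatives of
    both tuples with comparable, hence equal, positive types, and an automorphism
    of [M] between them acts on the classes.  Joint continuation, and the existence
    of [theta], come from compactness, proved with ultrapowers. *)
From mathcomp Require Import all_boot.
From mathcomp Require Import boolp classical_sets filter.
From Stdlib Require List Eqdep.
Require Import Defs.

Set Implicit Arguments.
Unset Strict Implicit.
Unset Printing Implicit Defensive.

Lemma dep_choice (A : Type) (B : A -> Type) (P : forall a, B a -> Prop) :
  (forall a, exists b, P a b) -> exists f : forall a, B a, forall a, P a (f a).
Proof. by move=> H; exists (fun a => sval (cid (H a))) => a; case: (cid _). Qed.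

(** * Small types *)

Section Small.
Variable sm : smallness.

Lemma small_surj (A B : Type) (f : B -> A) :
  (forall a, exists b, f b = a) -> sm B -> sm A.
Proof.
move=> fS smB; apply: (small_inj (f := fun a => sval (cid (fS a)))) smB.
by apply: (can_inj (g := f)) => a; case: (cid _).
Qed.

(** [f] need not land in [P], so no proof of [P] has to be carried along its values. *)
Lemma small_cover (A B : Type) (P : A -> Prop) (f : B -> A) :
  sm B -> (forall a, P a -> exists b, f b = a) -> sm {a | P a}.
Proof.
move=> smB fS; have fS' (p : {a | P a}) := cid (fS _ (svalP p)).
apply: (small_inj (f := fun p => sval (fS' p))) smB => p q.
case: (fS' p) => b /= bp; case: (fS' q) => c /= cq bc.
by case: p q bp cq => a Pa [a' Pa'] /= bp cq; apply: eq_exist; rewrite -bp -cq bc.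
Qed.

Lemma small_unit : sm unit.
Proof. by apply: (small_inj (f := fun=> 0)) (small_nat sm) => [[] []]. Qed.

Lemma small_bool : sm bool.
Proof. by apply: (small_inj (f := nat_of_bool)) (small_nat sm) => [[] []]. Qed.

Lemma small_sum (A B : Type) : sm A -> sm B -> sm (A + B)%type.
Proof.
move=> smA smB.
have smS : sm {b : bool & if b then A else B}.
  by apply: small_sigma small_bool _ => -[].
apply: (small_surj (f := fun p : {b : bool & if b then A else B} =>
  match p with
  | existT true a => inl a
  | existT false b => inr b
  end)) smS => -[a|b]; first by exists (existT (fun b : bool => if b then A else B) true a).
by exists (existT (fun b : bool => if b then A else B) false b).
Qed.

Lemma small_prod (A B : Type) : sm A -> sm B -> sm (A * B)%type.
Proof.
move=> smA smB.
apply: (small_surj (f := fun p : {_ : A & B} => (tag p, tagged p))).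
  by move=> [a b]; exists (existT _ a b).
exact: small_sigma.
Qed.

Lemma small_option (A : Type) : sm A -> sm (option A).
Proof.
move=> smA; apply: (small_surj (f := fun x : unit + A => if x is inr a then Some a else None)).
  by case=> [a|]; [exists (inr a) | exists (inl tt)].
exact: small_sum small_unit smA.
Qed.

Lemma small_fin_prod (n : nat) (B : 'I_n -> Type) :
  (forall i, sm (B i)) -> sm (forall i, B i).
Proof.
elim: n B => [|n IHn] B smB.
  apply: (small_inj (f := fun=> 0)) (small_nat sm) => f g _.
  by apply: functional_extensionality_dep; case.
have smP := small_prod (smB ord0) (IHn (fun i => B (lift ord0 i)) (fun=> smB _)).
apply: (small_inj (f := fun f : forall i, B i =>
  (f ord0, fun i => f (lift ord0 i)))) smP => f g [fg0 fgS].
apply: functional_extensionality_dep => i; case: (unliftP ord0 i) => [j|] -> //.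
by move: (congr1 (fun h => h j) fgS).
Qed.

Lemma small_list (A : Type) : sm A -> sm (list A).
Proof.
move=> smA; apply: (small_surj (f := fun p : {n : nat & 'I_n -> A} =>
  [seq tagged p i | i <- enum 'I_(tag p)])).
  move=> l; exists (existT (fun n => 'I_n -> A) (size l) (tnth (in_tuple l))) => /=.
  by rewrite map_tnth_enum.
apply: small_sigma (small_nat sm) _ => n.
exact: (small_fin_prod (B := fun=> A)).
Qed.

Lemma small_sub (A : Type) (P : A -> Prop) : sm A -> sm {a | P a}.
Proof. by move=> smA; apply: (small_cover (f := id)) smA _ => a _; exists a. Qed.

(** * Terms and formulas over a small signature *)

Section Formulas.
Variables (L : signature) (smL : small_signature sm L).

Fixpoint term_depth (X : ctx (sort L)) (s : sort L) (t : term X s) : nat :=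
  match t with
  | Var _ => 0
  | App f t => (\max_(i < farity f) term_depth (t i)).+1
  end.

Fixpoint formula_depth (X : ctx (sort L)) (phi : formula X) : nat :=
  match phi with
  | Eq _ _ _ | Rel _ _ | Top | Bot => 0
  | And phi psi | Or phi psi => (maxn (formula_depth phi) (formula_depth psi)).+1
  | Ex _ phi => (formula_depth phi).+1
  end.

Lemma small_term_depth (X : ctx (sort L)) n s :
  sm (var X) -> sm {t : term X s | term_depth t <= n}.
Proof.
move=> smX; have [smS smF _] := smL.
(* All sorts are counted together: arguments of an application have other sorts, and case analysis
   on a term needs its sort index free. *)
suff smT : sm {p : {s & term X s} | term_depth (tagged p) <= n}.
  apply: (small_inj (f := fun p : {t : term X s | term_depth t <= n} =>
    exist (fun p : {s & term X s} => is_true (term_depth (tagged p) <= n))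
      (existT _ s (sval p)) (svalP p))) smT => -[t tn] [u un] [] tu.
  by apply: eq_exist; apply: Eqdep.EqdepTheory.inj_pair2 tu.
elim: n => [|n IHn].
  apply: (small_cover (f := fun x : var X => existT (term X) _ (Var x))) smX _.
  by move=> [s' t] /=; case: t => [x _|f t] //; exists x.
have smT s' : sm {t : term X s' | term_depth t <= n}.
  apply: (small_inj (f := fun p : {t : term X s' | term_depth t <= n} =>
    exist (fun p : {s & term X s} => is_true (term_depth (tagged p) <= n))
      (existT _ s' (sval p)) (svalP p))) IHn => -[t tn] [u un] [] tu.
  by apply: eq_exist; apply: Eqdep.EqdepTheory.inj_pair2 tu.
have smA : sm {f : fsym L & forall i : 'I_(farity f),
    {t : term X (fdom i) | term_depth t <= n}}.
  by apply: small_sigma smF _ => f; apply: small_fin_prod.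
apply: (small_cover (f := fun p : var X + {f : fsym L & forall i : 'I_(farity f),
    {t : term X (fdom i) | term_depth t <= n}} =>
  match p with
  | inl x => existT (term X) _ (Var x)
  | inr q => existT (term X) _ (App (fun i => sval (tagged q i)))
  end)) (small_sum smX smA) _ => -[s' t] /=.
case: t => [x _|f t]; first by exists (inl x).
rewrite /= ltnS => /bigmax_leqP tn.
by exists (inr (existT (fun f => forall i : 'I_(farity f),
  {t : term X (fdom i) | term_depth t <= n}) f (fun i => exist _ (t i) (tn i isT)))).
Qed.

(** A countable union of small sets is small. *)
Lemma small_of_measure (A : Type) (d : A -> nat) :
  (forall n, sm {a | d a <= n}) -> sm A.
Proof.
move=> smd; have smS := small_sigma (small_nat sm) smd.
apply: (small_surj (f := fun p : {n & {a | d a <= n}} => sval (tagged p))) smS => a.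
by exists (existT (fun n => {a | d a <= n}) (d a) (exist _ a (leqnn _))).
Qed.

Lemma small_term (X : ctx (sort L)) s : sm (var X) -> sm (term X s).
Proof.
by move=> smX; apply: (small_of_measure (d := @term_depth X s)) => n; apply: small_term_depth.
Qed.

Lemma small_formula_depth (X : ctx (sort L)) n :
  sm (var X) -> sm {phi : formula X | formula_depth phi <= n}.
Proof.
have [smS _ smR] := smL.
(* The context stays general because the body of [Ex] has one more variable. *)
elim: n X => [|n IHn] X smX.
all: have smE : sm {s : sort L & (term X s * term X s)%type} by
    apply: small_sigma smS _ => s; apply: small_prod; apply: small_term.
all: have smA : sm {r : rsym L & forall i : 'I_(rarity r), term X (rdom i)} by
    apply: small_sigma smR _ => r; apply: small_fin_prod => i; apply: small_term.
  apply: (small_cover (f := fun p :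
      {s : sort L & (term X s * term X s)%type} +
      {r : rsym L & forall i : 'I_(rarity r), term X (rdom i)} + bool =>
    match p with
    | inl (inl (existT s (t, u))) => Eq t u
    | inl (inr (existT r t)) => Rel t
    | inr true => Top X
    | inr false => Bot X
    end)) (small_sum (small_sum smE smA) small_bool) _.
  case=> //= [s t u|r t||] _.
  - by exists (inl (inl (existT _ s (t, u)))).
  - by exists (inl (inr (existT _ r t))).
  - by exists (inr true).
  - by exists (inr false).
have smX1 s : sm (var (ctx_ext X s)) := small_option smX.
have smQ : sm {s : sort L & {phi : formula (ctx_ext X s) | formula_depth phi <= n}}.
  by apply: small_sigma smS _ => s; apply: IHn.
have smP := small_prod (IHn X smX) (IHn X smX).
apply: (small_cover (f := fun p :
      {s : sort L & (term X s * term X s)%type} +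
      {r : rsym L & forall i : 'I_(rarity r), term X (rdom i)} + bool +
      {phi : formula X | formula_depth phi <= n} *
        {phi : formula X | formula_depth phi <= n} * bool +
      {s : sort L & {phi : formula (ctx_ext X s) | formula_depth phi <= n}} =>
    match p with
    | inl (inl (inl (inl (existT s (t, u))))) => Eq t u
    | inl (inl (inl (inr (existT r t)))) => Rel t
    | inl (inl (inr true)) => Top X
    | inl (inl (inr false)) => Bot X
    | inl (inr (phi, psi, true)) => And (sval phi) (sval psi)
    | inl (inr (phi, psi, false)) => Or (sval phi) (sval psi)
    | inr (existT s phi) => Ex (sval phi)
    end)) (small_sum (small_sum (small_sum (small_sum smE smA) small_bool)
      (small_prod smP small_bool)) smQ) _.
case=> [s t u|r t|||phi psi|phi psi|s phi] /=.
- by exists (inl (inl (inl (inl (existT _ s (t, u)))))).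
- by exists (inl (inl (inl (inr (existT _ r t))))).
- by exists (inl (inl (inr true))).
- by exists (inl (inl (inr false))).
- rewrite ltnS geq_max => /andP[phin psin].
  by exists (inl (inr (exist _ phi phin, exist _ psi psin, true))).
- rewrite ltnS geq_max => /andP[phin psin].
  by exists (inl (inr (exist _ phi phin, exist _ psi psin, false))).
- rewrite ltnS => phin.
  by exists (inr (existT (fun s => {phi : formula (ctx_ext X s) | formula_depth phi <= n})
    s (exist _ phi phin))).
Qed.

Lemma small_formula (X : ctx (sort L)) : sm (var X) -> sm (formula X).
Proof.
move=> smX; apply: (small_of_measure (d := @formula_depth X)) => n.
exact: small_formula_depth.
Qed.

End Formulas.
End Small.

(** * Substitution and quantification over tuples of variables *)

Section Syntax.
Variable L : signature.
Implicit Types (M N : structure L) (X Y : ctx (sort L)).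

Fixpoint term_subst X Y (sigma : forall x : var X, term Y (srt x)) s (t : term X s) :
    term Y s :=
  match t with
  | Var x => sigma x
  | App f t => App (fun i => term_subst sigma (t i))
  end.

Lemma eval_subst M X Y (sigma : forall x : var X, term Y (srt x)) (c : assignment M Y)
    s (t : term X s) :
  eval c (term_subst sigma t) = eval (fun x => eval c (sigma x)) t.
Proof.
elim: t => //= f t IHt; congr fint.
by apply: functional_extensionality_dep => i.
Qed.

Lemma In_mem (T : eqType) (x : T) (s : seq T) : x \in s -> List.In x s.
Proof.
by elim: s => //= y s IHs; rewrite inE => /orP[/eqP->|/IHs]; [left|right].
Qed.

Lemma In_pmap_id (A : Type) (x : A) (l : list (option A)) :
  List.In (Some x) l -> List.In x (pmap id l).
Proof.
elim: l => //= -[y|] l IHl [] //; last by move/IHl; right.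
by case=> ->; left.
Qed.

(** The membership proof is an argument because a variable outside [l] may have a sort without any
    term to serve as default. *)
Definition partial_subst X Y (l : list (var X)) :=
  forall x : var X, List.In x l -> term Y (srt x).

Definition realizes M X Y l (sigma : @partial_subst X Y l) (a : assignment M X)
    (c : assignment M Y) : Prop :=
  forall x (xl : List.In x l), eval c (sigma x xl) = a x.

Definition sub_left X Y (l l' : list (var X)) (sigma : @partial_subst X Y (l ++ l')) :
    partial_subst Y l :=
  fun x xl => sigma x (List.in_or_app _ _ _ (or_introl xl)).

Definition sub_right X Y (l l' : list (var X)) (sigma : @partial_subst X Y (l ++ l')) :
    partial_subst Y l' :=
  fun x xl => sigma x (List.in_or_app _ _ _ (or_intror xl)).

(** [l] lists the variables that occur in [t]. The new term is specified by its value in all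
    structures at once, which spares syntactic substitution lemmas later. *)
Lemma term_support X s (t : term X s) :
  exists l : list (var X), forall Y (sigma : partial_subst Y l), exists t' : term Y s,
    forall M (a : assignment M X) (c : assignment M Y),
      realizes sigma a c -> eval c t' = eval a t.
Proof.
elim: t => [x|f t /choice[l lP]].
  exists [:: x] => Y sigma; exists (sigma x (or_introl erefl)) => M a c.
  by move=> ->.
pose e := enum 'I_(farity f).
have el i : List.In i e by apply: In_mem; rewrite mem_enum.
exists (List.flat_map l e) => Y sigma.
pose sigma_ i : partial_subst Y (l i) := fun x xl =>
  sigma x (proj2 (List.in_flat_map l e x) (ex_intro _ i (conj (el i) xl))).
have [t' t'P] := dep_choice (fun i => lP i Y (sigma_ i)).
exists (App t') => M a c ac /=; congr fint.
by apply: functional_extensionality_dep => i; apply: t'P => x xl; apply: ac.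
Qed.

(** Contexts may be infinite, but truth depends on the finitely many variables that occur.
    Substitution, quantification over tuples and the symbols [R_psi] all rest on this. *)
Lemma formula_support X (phi : formula X) :
  exists l : list (var X), forall Y (sigma : partial_subst Y l), exists psi : formula Y,
    forall M (a : assignment M X) (c : assignment M Y),
      realizes sigma a c -> sat psi c <-> sat phi a.
Proof.
elim: phi => {X} [X s t u|X r t|X|X|X phi [l lP] psi [l' l'P]
    |X phi [l lP] psi [l' l'P]|X s phi [l lP]].
- have [l lP] := term_support t; have [l' l'P] := term_support u.
  exists (l ++ l') => Y sigma.
  have [t' t'P] := lP Y (sub_left sigma); have [u' u'P] := l'P Y (sub_right sigma).
  exists (Eq t' u') => M a c ac /=.
  by rewrite (t'P M a c) ?(u'P M a c) // => x xl; apply: ac.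
- have [l lP] := choice (fun i => term_support (t i)).
  pose e := enum 'I_(rarity r).
  have el i : List.In i e by apply: In_mem; rewrite mem_enum.
  exists (List.flat_map l e) => Y sigma.
  pose sigma_ i : partial_subst Y (l i) := fun x xl =>
    sigma x (proj2 (List.in_flat_map l e x) (ex_intro _ i (conj (el i) xl))).
  have [t' t'P] := dep_choice (fun i => lP i Y (sigma_ i)).
  exists (Rel t') => M a c ac /=.
  suff -> : (fun i => eval c (t' i)) = (fun i => eval a (t i)) by [].
  by apply: functional_extensionality_dep => i; apply: t'P => x xl; apply: ac.
- by exists [::] => Y sigma; exists (Top Y).
- by exists [::] => Y sigma; exists (Bot Y).
- exists (l ++ l') => Y sigma.
  have [t' t'P] := lP Y (sub_left sigma); have [u' u'P] := l'P Y (sub_right sigma).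
  exists (And t' u') => M a c ac /=.
  by rewrite (t'P M a c) ?(u'P M a c) // => x xl; apply: ac.
- exists (l ++ l') => Y sigma.
  have [t' t'P] := lP Y (sub_left sigma); have [u' u'P] := l'P Y (sub_right sigma).
  exists (Or t' u') => M a c ac /=.
  by rewrite (t'P M a c) ?(u'P M a c) // => x xl; apply: ac.
(* [pmap id] drops the bound variable [None]; [sigma'] sends it to itself and weakens all other
   terms. *)
- exists (pmap id l) => Y sigma.
  pose weaken s' (t : term Y s') : term (ctx_ext Y s) s' :=
    term_subst (fun y => @Var L (ctx_ext Y s) (Some y)) t.
  pose sigma' : @partial_subst (ctx_ext X s) (ctx_ext Y s) l := fun o =>
    match o return List.In o l -> term (ctx_ext Y s) (srt (c := ctx_ext X s) o) with
    | None => fun _ => @Var L (ctx_ext Y s) None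
    | Some x => fun xl => weaken _ (sigma x (In_pmap_id xl))
    end.
  have [psi psiP] := lP _ sigma'.
  exists (Ex psi) => M a c ac /=.
  have acm (m : M s) : realizes sigma' (assign_ext a m) (assign_ext c m).
    by case=> [x|] xl //=; rewrite eval_subst; apply: ac.
  by split=> -[m /(psiP _ _ _ (acm m))]; exists m.
Qed.

Lemma formula_subst X Y (sigma : forall x : var X, term Y (srt x)) (phi : formula X) :
  exists psi : formula Y, forall M (c : assignment M Y),
    sat psi c <-> sat phi (fun x => eval c (sigma x)).
Proof.
have [l /(_ Y (fun x _ => sigma x))[psi psiP]] := formula_support phi.
by exists psi => M c; apply: psiP.
Qed.

Lemma assignment_update M Y (b : assignment M Y) (y : var Y) (m : M (srt y)) :
  exists b' : assignment M Y, b' y = m /\ forall z, z <> y -> b' z = b z.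
Proof.
have /(_ _)/cid-b'P z : exists m' : M (srt z),
    (forall e : z = y, eq_rect _ (fun u => M (srt u)) m' _ e = m) /\ (z <> y -> m' = b z).
  have [->|zy] := pselect (z = y); last by exists (b z); split.
  by exists m; split=> // e; rewrite (Prop_irrelevance e erefl).
exists (fun z => sval (b'P z)); split=> [|z]; case: (b'P _) => m' /= [] //.
by move=> /(_ erefl).
Qed.

(* [W] extends [X] by one variable for each variable of [Y] in [l], and [close]
   quantifies these existentially. *)
Lemma close_list X Y (l : list (var Y)) :
  exists (W : ctx (sort L)) (sX : forall x : var X, term W (srt x))
    (sY : partial_subst W l) (close : formula W -> formula X),
  [/\ forall M (a : assignment M X) (b : assignment M Y),
        exists w : assignment M W, (forall x, eval w (sX x) = a x) /\ realizes sY b w,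
      forall M (w : assignment M W) (b : assignment M Y),
        exists b' : assignment M Y, realizes sY b' w
    & forall M (a : assignment M X) phi, sat (close phi) a <->
        exists w : assignment M W, (forall x, eval w (sX x) = a x) /\ sat phi w].
Proof.
elim: l => [|y l [W [sX [sY [close [fwd bwd closeP]]]]]].
  have sY0 : partial_subst X ([::] : list (var Y)) by move=> y [].
  exists X, (@Var L X), sY0, id; split.
  - by move=> M a b; exists a; split=> // y [].
  - by move=> M w b; exists b => y [].
  - move=> M a phi; split=> [|[w [wa]]]; first by exists a.
    by suff -> : w = a by []; apply: functional_extensionality_dep.
(* A repeated variable already has its quantified copy, so [W] is kept. *)
have [yl|yl] := pselect (List.In y l).
  have in_l z : List.In z (y :: l) -> List.In z l by case=> [<-|].
  exists W, sX, (fun z zl => sY z (in_l z zl)), close; split=> // M a b.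
    by have [w [wa wb]] := fwd M a b; exists w; split=> // z zl; apply: wb.
  by have [b' b'P] := bwd M a b; exists b' => z zl; apply: b'P.
pose W' := ctx_ext W (srt y).
pose weaken s (t : term W s) : term W' s :=
  term_subst (fun y => @Var L W' (Some y)) t.
have eval_weaken M (w : assignment M W') s (t : term W s) :
  eval w (weaken s t) = eval (fun x => w (Some x)) t by rewrite eval_subst.
have sY'P z : exists t : List.In z (y :: l) -> term W' (srt z),
    forall (zl : List.In z (y :: l)) M (w : assignment M W') (b : assignment M Y),
    w None = b y -> realizes sY b (fun x => w (Some x)) -> eval w (t zl) = b z.
  have [->|zy] := pselect (z = y).
    by exists (fun=> @Var L W' None).
  have in_l : List.In z (y :: l) -> List.In z l by case=> // /esym.
  exists (fun zl => weaken _ (sY z (in_l zl))) => zl M w b _ wb.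
  by rewrite eval_weaken; apply: wb.
exists W', (fun x => weaken _ (sX x)), (fun z => sval (cid (sY'P z))),
  (fun phi => close (Ex phi)); split.
- move=> M a b; have [w [wa wb]] := fwd M a b.
  exists (assign_ext w (b y)); split=> [x|z zl]; first by rewrite eval_weaken; apply: wa.
  by case: (cid _) => t tP /=; apply: tP.
- move=> M w b; have [b1 b1P] := bwd M (fun x => w (Some x)) b.
  have [b' [b'y b'z]] := assignment_update b1 (w None : M (srt y)).
  exists b' => z zl; case: (cid _) => t tP /=; apply: tP => // u ul.
  by rewrite b'z ?b1P // => uy; apply: yl; rewrite -uy.
- move=> M a phi; rewrite closeP; split=> [[w [wa /= [m wm]]]|[w [wa wphi]]].
    by exists (assign_ext w m); split=> // x; rewrite eval_weaken; apply: wa.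
  exists (fun x => w (Some x)); split=> [x|]; first by rewrite -wa eval_weaken.
  exists (w None : M (srt y)); suff -> : assign_ext (fun x => w (Some x)) (w None : M (srt y)) = w by [].
  by apply: functional_extensionality_dep; case.
Qed.

(** Only the variables of [Y] occurring in [phi] are quantified. The others need some value, and
    sorts may be empty, so the second half asks for an assignment of [Y]. *)
Lemma exists_formula X Y (phi : formula (ctx_sum X Y)) :
  exists psi : formula X, forall M (a : assignment M X),
    ((exists b : assignment M Y, sat phi (assign_sum a b)) -> sat psi a) /\
    (assignment M Y -> sat psi a -> exists b : assignment M Y, sat phi (assign_sum a b)).
Proof.
have [l lP] := formula_support phi.
pose l' := pmap (fun z => if z is inr y then Some y else None) l.
have l'P y : List.In (inr y) l -> List.In y l'.
  rewrite /l'; elim: l {lP l'} => //= z l IHl [->|/IHl]; first by left.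
  by case: z => // y'; right.
have [W [sX [sY [close [fwd bwd closeP]]]]] := close_list X l'.
pose sigma : @partial_subst (ctx_sum X Y) W l := fun z =>
  match z return List.In z l -> term W (srt (c := ctx_sum X Y) z) with
  | inl x => fun _ => sX x
  | inr y => fun yl => sY y (l'P y yl)
  end.
have [psi psiP] := lP W sigma.
exists (close psi) => M a; split=> [[b ab]|b /closeP[w [wa wpsi]]].
  apply/closeP; have [w [wa wb]] := fwd M a b; exists w; split=> //.
  by apply/(psiP M (assign_sum a b) w) => // -[x|y] zl; [apply: wa|apply: wb].
have [b' b'P] := bwd M w b; exists b'.
by apply/(psiP M _ w) => // -[x|y] zl; [apply: wa|apply: b'P].
Qed.

Definition conj X (l : list (formula X)) : formula X := foldr (@And L X) (Top X) l.

Lemma sat_conj M X (l : list (formula X)) (a : assignment M X) :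
  sat (conj l) a <-> forall phi, List.In phi l -> sat phi a.
Proof.
elim: l => [|phi l IHl] /=; first by split.
rewrite IHl; split=> [[aphi al] psi [<- //|/al //]|al].
by split=> [|psi psil]; apply: al; [left|right].
Qed.

(** * Transfer of satisfiability between structures *)

Definition empty_ctx : ctx (sort L) :=
  Ctx (fun i : 'I_0 => match notF (ltn_ord i) with end).

Definition no_assignment M : assignment M empty_ctx :=
  fun i => match notF (ltn_ord i) with end.

(** With [hstructure calE] for [M], this unfolds to [model (htheory calE) N]. *)
Definition transfers M N : Prop := forall chi : hsentence L, holds M chi -> holds N chi.

(** If [psi] failed in [M], the h-inductive sentence [psi -> Bot] would hold in [M], hence in
    [N]. *)
Lemma sentence_transfer M N (psi : formula empty_ctx) :
  transfers M N -> (exists a : assignment N empty_ctx, sat psi a) ->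
  exists a : assignment M empty_ctx, sat psi a.
Proof.
move=> MN [a apsi]; apply: contrapT => none.
by apply: (MN (HSentence psi (Bot empty_ctx)) _ a apsi) => b bpsi; apply: none; exists b.
Qed.

Lemma satisfiable_transfer M N X (phi : formula X) (a : assignment N X) :
  transfers M N -> sat phi a -> exists b : assignment M X, sat phi b.
Proof.
move=> MN aphi.
(* To undo the existential closure in [M], the sorts of [X] must be inhabited there; the sentences
   [exists x, Top] ensure it. *)
have /dep_choice[d _] (x : var X) : exists _ : M (srt x), True.
  have [|b [m _]] := @sentence_transfer M N (@Ex L empty_ctx (srt x) (Top _)) MN.
    by exists (@no_assignment N), (a x).
  by exists m.
have [phi' phi'P] := @formula_subst X (ctx_sum empty_ctx X)
  (fun x => @Var L (ctx_sum empty_ctx X) (inr x)) phi.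
have [psi psiP] := exists_formula phi'.
have [|b bpsi] := @sentence_transfer M N psi MN.
  exists (@no_assignment N); apply: (psiP N _).1; exists a.
  by apply/phi'P.
have [c /phi'P c_phi] := (psiP M b).2 d bpsi.
by exists c.
Qed.

End Syntax.

(** * Compactness by ultrapowers *)

Section Ultrapower.
Variables (L : signature) (M : structure L) (J : Type) (U : set_system J).
Hypothesis UU : UltraFilter U.

Let FU : Filter U := @filter_filter _ _ (@ultra_proper _ _ UU).

Lemma ultra_and (P Q : J -> Prop) : U (fun j => P j /\ Q j) <-> U P /\ U Q.
Proof.
split=> [UPQ|[UP UQ]]; last exact: filterI UP UQ.
by split; apply: filterS UPQ => j [].
Qed.

Lemma ultra_or (P Q : J -> Prop) : U (fun j => P j \/ Q j) <-> U P \/ U Q.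
Proof.
split=> [UPQ|[UP|UQ]]; last 2 first.
- by apply: filterS UP => j; left.
- by apply: filterS UQ => j; right.
have [|UnP] := in_ultra_setVsetC P UU; first by left.
by right; apply: filterS (filterI UPQ UnP) => j [[]].
Qed.

Lemma ultra_all n (P : 'I_n -> J -> Prop) :
  (forall i, U (P i)) -> U (fun j => forall i, P i j).
Proof. exact: filter_forall. Qed.

Lemma ultra_nonempty (P : J -> Prop) : U P -> exists j, P j.
Proof.
move=> UP; apply: contrapT => none; apply: (filter_not_empty U).
by apply: filterS UP => j Pj; apply: none; exists j.
Qed.

Definition same_germ s (f g : J -> M s) : Prop := U (fun j => f j = g j).

Definition upower_carrier (s : sort L) : Type :=
  {C : (J -> M s) -> Prop | exists f, C = same_germ f}.

Definition germ s (f : J -> M s) : upower_carrier s :=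
  exist _ (same_germ f) (ex_intro _ f erefl).

Definition germ_rep s (k : upower_carrier s) : J -> M s := sval (cid (svalP k)).

Lemma germ_eq s (f g : J -> M s) : germ f = germ g <-> same_germ f g.
Proof.
split=> [/(congr1 sval) /= fg|fg].
  by rewrite fg; apply: filterS filterT.
apply: eq_exist; apply: funext => h; apply: propext; split=> Uh.
  by apply: filterS (filterI fg Uh) => j [/= <-].
by apply: filterS (filterI fg Uh) => j [/= ->].
Qed.

Lemma germ_repK s (k : upower_carrier s) : germ (germ_rep k) = k.
Proof. by rewrite /germ_rep; case: k => C kP; apply: eq_exist; case: (cid _). Qed.

Lemma same_germ_rep s (f : J -> M s) : same_germ (germ_rep (germ f)) f.
Proof. by apply/germ_eq; rewrite germ_repK. Qed.

(** Symbols act on chosen representatives. The choice is harmless: there are finitely many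
    arguments, and representatives agree [U]-almost everywhere. *)
Definition upower : structure L :=
  @Structure L upower_carrier
    (fun f k => germ (fun j => fint (fun i => germ_rep (k i) j)))
    (fun r k => U (fun j => rint (fun i => germ_rep (k i) j))).

Lemma upower_eval X (a : forall x : var X, J -> M (srt x)) s (t : term X s) :
  eval (M := upower) (fun x => germ (a x)) t = germ (fun j => eval (fun x => a x j) t).
Proof.
elim: t => //= f t IHt; apply/germ_eq.
apply: filterS (ultra_all (fun i => same_germ_rep (fun j => eval (fun x => a x j) (t i)))).
move=> j jP /=; congr fint.
by apply: functional_extensionality_dep => i; rewrite IHt jP.
Qed.

(** Łoś's theorem for positive formulas. [Or] uses that [U] is ultra; for [Ex], witnesses are chosen
    index by index. *)
Lemma upower_sat X (phi : formula X) (a : forall x : var X, J -> M (srt x)) :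
  sat (M := upower) phi (fun x => germ (a x)) <-> U (fun j => sat phi (fun x => a x j)).
Proof.
elim: phi a => {X} [X s t u|X r t|X|X|X phi IHphi psi IHpsi|X phi IHphi psi IHpsi|X s phi IHphi] a /=.
- by rewrite !upower_eval germ_eq.
- have Ut := ultra_all (fun i => same_germ_rep (fun j => eval (fun x => a x j) (t i))).
  have jP j : (forall i, germ_rep (germ (fun j => eval (fun x => a x j) (t i))) j =
      eval (fun x => a x j) (t i)) ->
    (fun i => germ_rep (eval (M := upower) (fun x => germ (a x)) (t i)) j) =
    (fun i => eval (fun x => a x j) (t i)).
    by move=> jP; apply: functional_extensionality_dep => i; rewrite upower_eval jP.
  by split=> Ur; apply: filterS (filterI Ut Ur) => j [/jP] /= ->.
- by split=> // _; apply: filterS filterT.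
- by split=> // /ultra_nonempty[].
- by rewrite IHphi IHpsi ultra_and.
- by rewrite IHphi IHpsi ultra_or.
- have ext (m : J -> M s) :
      sat (M := upower) phi (assign_ext (M := upower) (fun x => germ (a x)) (germ m)) <->
      U (fun j => sat phi (assign_ext (fun x => a x j) (m j))).
    pose am (o : var (ctx_ext X s)) : J -> M (srt o) :=
      fun j => assign_ext (fun x => a x j) (m j) o.
    rewrite -(IHphi am).
    suff -> : assign_ext (M := upower) (fun x => germ (a x)) (germ m) = (fun o => germ (am o)) by [].
    by apply: functional_extensionality_dep; case.
  split=> [[k]|Uex].
    rewrite -[k]germ_repK => /ext; apply: filterS => j /= kj.
    by exists (germ_rep k j).
  (* [m0] is the default at indices without a witness; it is taken from an index that has one, as
     the sort could be empty. *)
  have [j0 [m0 _]] := ultra_nonempty Uex.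
  have /choice[m mP] j : exists m : M s, (exists m, sat phi (assign_ext (fun x => a x j) m)) ->
      sat phi (assign_ext (fun x => a x j) m).
    have [[m jm]|none] := pselect (exists m, sat phi (assign_ext (fun x => a x j) m)).
      by exists m.
    by exists m0.
  by exists (germ m); apply/ext; apply: filterS Uex => j; apply: mP.
Qed.

Lemma upower_transfers : transfers M upower.
Proof.
move=> chi Mchi a.
have -> : a = fun x => germ (germ_rep (a x)).
  by apply: functional_extensionality_dep => x; rewrite germ_repK.
by move=> /upower_sat prem; apply/upower_sat; apply: filterS prem => j; apply: Mchi.
Qed.

End Ultrapower.

(** The index set is that of finite lists from [D], with an ultrafilter containing, for each
    formula, the set of lists that include it. Each list gets a solution in [M], and the germs of
    these solutions realise [D]. *)
Lemma compactness L (M : structure L) (Z : ctx (sort L)) (D : formula Z -> Prop) :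
  (forall l : list (formula Z), (forall phi, List.In phi l -> D phi) ->
     exists a : assignment M Z, forall phi, List.In phi l -> sat phi a) ->
  exists (N : structure L) (c : assignment N Z),
    transfers M N /\ forall phi, D phi -> sat phi c.
Proof.
move=> Dfin; pose J := list {phi | D phi}.
pose F : set_system J := fun S => exists j, forall j', List.incl j j' -> S j'.
have PF : ProperFilter F.
  split; first by move=> [j /(_ j (List.incl_refl j))].
  split; first by exists [::].
  - move=> P Q [j jP] [j' j'Q]; exists (j ++ j') => j'' sub; split.
      by apply: jP => p pj; apply/sub/List.in_or_app; left.
    by apply: j'Q => p pj; apply/sub/List.in_or_app; right.
  - by move=> P Q PQ [j jP]; exists j => j' /jP /PQ.
have [U [UU FU]] := ultraFilterLemma PF.
have /dep_choice[a aP] (j : J) : exists a : assignment M Z,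
    forall p, List.In p j -> sat (sval p) a.
  have [|a aP] := Dfin (map sval j).
    by move=> phi /List.in_map_iff[[psi Dpsi] [<-]].
  by exists a => p pj; apply: aP; apply: List.in_map pj.
exists (upower M U), (fun z => germ U (fun j => a j z)); split; first exact: upower_transfers.
move=> phi Dphi; apply/(upower_sat UU); apply: FU; exists [:: exist _ phi Dphi] => j sub.
by apply: (aP j (exist _ phi Dphi)); apply: sub; left.
Qed.

Lemma compactness_filter L (M : structure L) (Z : ctx (sort L)) (D : formula Z -> Prop) :
  D (Top Z) -> (forall phi psi, D phi -> D psi -> D (And phi psi)) ->
  (forall phi, D phi -> exists a : assignment M Z, sat phi a) ->
  exists (N : structure L) (c : assignment N Z),
    transfers M N /\ forall phi, D phi -> sat phi c.
Proof.
move=> D1 DI Dsat; apply: compactness => l lD.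
have /Dsat[a /sat_conj al] : D (conj l); last by exists a.
elim: l lD => //= phi l IHl lD.
by apply: DI; [apply: lD; left | apply: IHl => psi psil; apply: lD; right].
Qed.

(** * Diagrams, joint continuation and positively closed models *)

Definition self_assignment L (M : structure L) : assignment M (params M) := fun p => tagged p.

(** The hypothesis says that [c] realises the positive diagram of [M]; replacing each variable by
    the name of its value puts [phi] into that diagram. *)
Lemma diagram_homomorphism L (M N : structure L) (c : assignment N (params M)) :
  (forall phi, sat phi (@self_assignment L M) -> sat phi c) ->
  homomorphism (fun s (m : M s) => c (existT _ s m)).
Proof.
move=> cP X phi a aphi.
have [psi psiP] := formula_subst
  (fun x : var X => @Var L (params M) (existT M (srt x) (a x))) phi.
by apply/(psiP N c)/cP/psiP.
Qed.

(** The positive diagrams of [A] and [B] use disjoint variables, and each of their formulas is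
    satisfiable in [M] by transfer, so their union is finitely satisfiable in [M]. *)
Lemma joint_continuation L (M A B : structure L) :
  transfers M A -> transfers M B ->
  exists (K : structure L) (f : forall s, A s -> K s) (g : forall s, B s -> K s),
    [/\ transfers M K, homomorphism f & homomorphism g].
Proof.
move=> MA MB; pose Z := ctx_sum (params A) (params B).
(* Taking semantic consequences of one formula from each diagram makes [D] closed under conjunction
   without rewriting formulas into [Z]. *)
pose D (phi : formula Z) := exists dA dB,
  [/\ sat dA (@self_assignment L A), sat dB (@self_assignment L B) &
    forall (K : structure L) (c : assignment K (params A)) (d : assignment K (params B)),
      sat dA c -> sat dB d -> sat phi (assign_sum c d)].
have [|phi psi||K [c [MK cP]]] := @compactness_filter L M Z D.
- by exists (Top _), (Top _).
- move=> [dA [dB [dA1 dB1 dP]]] [eA [eB [eA1 eB1 eP]]].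
  exists (And dA eA), (And dB eB); split=> // K c d [dAc eAc] [dBd eBd].
  by split; [apply: dP | apply: eP].
- move=> phi [dA [dB [/(satisfiable_transfer MA)[c cA] /(satisfiable_transfer MB)[d dB1] dP]]].
  by exists (assign_sum c d); apply: dP.
exists K, (fun s m => c (inl (existT _ s m))), (fun s m => c (inr (existT _ s m))).
split=> //.
  apply: (diagram_homomorphism (c := fun p => c (inl p))) => phi phi1.
  have [psi psiP] := formula_subst (fun p : var (params A) => @Var L Z (inl p)) phi.
  apply/(psiP K c)/cP; exists phi, (Top _); split=> // N c' d' phic _.
  exact/psiP.
apply: (diagram_homomorphism (c := fun p => c (inr p))) => phi phi1.
have [psi psiP] := formula_subst (fun p : var (params B) => @Var L Z (inr p)) phi.
apply/(psiP K c)/cP; exists (Top _), phi; split=> // N c' d' _ phic.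
exact/psiP.
Qed.

(** * Positively closed models *)

Section PositivelyClosed.
Variables (L : signature) (T : theory L) (M : structure L).
Hypothesis pcM : pc_model T M.

(** Otherwise every formula true of [a] is compatible with [psi]. Compactness then gives a
    homomorphism from [M] to a model of [T] in which the image of [a] satisfies [psi], and
    reflection gives [psi] at [a]. *)
Lemma pc_incompatible X (psi : formula X) (a : assignment M X) :
  ~ sat psi a ->
  exists2 theta : formula X, sat theta a & forall b : assignment M X, sat theta b -> ~ sat psi b.
Proof.
move=> apsi; apply: contrapT => none; apply: apsi.
have [TM pcM'] := pcM; pose Z := ctx_sum X (params M).
(* Consequences of [psi(x)] and the positive diagram of [M], in which [x] also names the tuple
   [a]. *)
pose D (phi : formula Z) := exists2 d, sat d (assign_sum a (@self_assignment L M)) &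
  forall (b : assignment M X) c, sat d (assign_sum b c) -> sat psi b -> sat phi (assign_sum b c).
have [|phi1 phi2||N [c [MN cP]]] := @compactness_filter L M Z D.
- by exists (Top _).
- move=> [d ad dP] [e ae eP]; exists (And d e) => // b c [bd be] bpsi.
  by split; [apply: dP | apply: eP].
(* Quantifying the parameters out of [d] leaves a formula true of [a], hence compatible with
   [psi]. *)
- move=> phi [d ad dP]; have [theta thetaP] := exists_formula d.
  have [b [btheta bpsi]] : exists b : assignment M X, sat theta b /\ sat psi b.
    apply: contrapT => nob; apply: none; exists theta.
      by apply: (thetaP M a).1; exists (@self_assignment L M).
    by move=> b btheta bpsi; apply: nob; exists b.
  have [c bc] := (thetaP M b).2 (@self_assignment L M) btheta.
  by exists (assign_sum b c); apply: dP.
pose h s (m : M s) : N s := c (inr (existT _ s m)).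
apply: (pcM' N h).
- by move=> chi Tchi; apply/MN/TM.
- apply: (diagram_homomorphism (c := fun p => c (inr p))) => phi phi1.
  have [phi' phi'P] := formula_subst (fun p : var (params M) => @Var L Z (inr p)) phi.
  by apply/(phi'P N c)/cP; exists phi' => //; apply/phi'P.
suff -> : (fun x => h _ (a x)) = (fun x => c (inl x)).
  have [psi' psi'P] := formula_subst (fun x : var X => @Var L Z (inl x)) psi.
  apply/(psi'P N c)/cP; exists (Top _) => // b d _ bpsi.
  exact/psi'P.
apply: functional_extensionality_dep => x; apply/esym.
(* This equation lies in [D]; it forces the value of [x] in [N] to be the image of [a x]. *)
pose e := Eq (@Var L Z (inl x)) (@Var L Z (inr (existT M (srt x) (a x)))).
by apply: (cP e); exists e.
Qed.

(** A formula false at [a] is excluded by a positive [theta] true at [a], and [theta] passes to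
    [b]. *)
Lemma pc_type_maximal X (a b : assignment M X) :
  (forall phi : formula X, sat phi a -> sat phi b) ->
  forall phi : formula X, sat phi a <-> sat phi b.
Proof.
move=> ab phi; split=> [/ab //|bphi]; apply: contrapT => /pc_incompatible[theta atheta].
by move=> /(_ b (ab _ atheta)).
Qed.

End PositivelyClosed.

(** * Type-definable sets *)

Section TypeDefinable.
Variables (sm : smallness) (L : signature) (M : structure L).
Hypothesis satM : small_saturated sm M.

(** A family over a small index type, not a set of formulas: unions of partial types become sigma
    types. *)
Definition tdef (X : ctx (sort L)) (P : assignment M X -> Prop) : Prop :=
  exists (K : Type) (Phi : K -> formula X),
    sm K /\ forall a, P a <-> forall k, sat (Phi k) a.

Lemma eq_tdef X (P Q : assignment M X -> Prop) :
  (forall a, P a <-> Q a) -> tdef P -> tdef Q.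
Proof. by move=> PQ [K [Phi [smK PhiP]]]; exists K, Phi; split=> // a; rewrite -PQ. Qed.

Lemma tdef_sat X (phi : formula X) : tdef (sat phi).
Proof.
exists unit, (fun=> phi); split; first exact: small_unit.
by move=> a; split=> [//|/(_ tt)].
Qed.

Lemma tdef_all X (K : Type) (P : K -> assignment M X -> Prop) :
  sm K -> (forall k, tdef (P k)) -> tdef (fun a => forall k, P k a).
Proof.
move=> smK /dep_choice[K' /dep_choice[Phi PhiP]].
exists {k & K' k}, (fun q => Phi _ (tagged q)); split.
  by apply: small_sigma => // k; case: (PhiP k).
move=> a; split=> [aP [k k']|aPhi k]; first by apply: ((PhiP k).2 a).1.
by apply/(PhiP k).2 => k'; apply: (aPhi (existT _ k k')).
Qed.

Lemma tdef_and X (P Q : assignment M X -> Prop) :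
  tdef P -> tdef Q -> tdef (fun a => P a /\ Q a).
Proof.
move=> Pd Qd; apply: (@eq_tdef X (fun a => forall b : bool, if b then P a else Q a)).
  by move=> a; split=> [PQ|[Pa Qa] []] //; split; [apply: (PQ true)|apply: (PQ false)].
by apply: tdef_all (small_bool sm) _ => -[].
Qed.

Lemma tdef_or X (P Q : assignment M X -> Prop) :
  tdef P -> tdef Q -> tdef (fun a => P a \/ Q a).
Proof.
move=> [K [Phi [smK PhiP]]] [K' [Psi [smK' PsiP]]].
exists (K * K')%type, (fun k => Or (Phi k.1) (Psi k.2)); split; first exact: small_prod.
move=> a; rewrite PhiP PsiP; split=> [[aPhi [k k']|aPsi [k k']]|aOr].
- by left.
- by right.
apply: contrapT => /not_orP[/existsNP[k kP] /existsNP[k' k'P]].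
by case: (aOr (k, k')).
Qed.

Lemma tdef_subst X Y (sigma : forall x : var X, term Y (srt x)) (P : assignment M X -> Prop) :
  tdef P -> tdef (fun a : assignment M Y => P (fun x => eval a (sigma x))).
Proof.
move=> [K [Phi [smK PhiP]]].
have [Psi PsiP] := choice (fun k => formula_subst sigma (Phi k)).
exists K, Psi; split=> // a; rewrite PhiP.
by split=> aP k; apply/PsiP.
Qed.

(** Substituting names for the entries of [d] turns the defining formulas into formulas with
    parameters, still small in number. *)
Lemma tdef_saturated X Y (K : Type) (P : K -> assignment M (ctx_sum X Y) -> Prop)
    (d : assignment M Y) :
  sm K -> (forall k, tdef (P k)) ->
  (forall l : list K, exists a : assignment M X,
     forall k, List.In k l -> P k (assign_sum a d)) ->
  exists a : assignment M X, forall k, P k (assign_sum a d).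
Proof.
move=> smK /dep_choice[K' /dep_choice[Phi PhiP]] fin.
pose Z := ctx_sum X (params M).
pose sigma (z : var (ctx_sum X Y)) : term Z (srt z) :=
  match z return term Z (srt (c := ctx_sum X Y) z) with
  | inl x => @Var L Z (inl x)
  | inr y => @Var L Z (inr (existT M (srt y) (d y)))
  end.
have [f fP] := choice (fun q : {k & K' k} => formula_subst sigma (Phi _ (tagged q))).
have fP' q (a : assignment M X) : sat_params (f q) a <-> sat (Phi _ (tagged q)) (assign_sum a d).
  rewrite /sat_params fP; split; congr sat;
  by apply: functional_extensionality_dep; case.
have [|n phi phif|a aP] := satM (X := X) (Phi := fun psi => exists q, f q = psi).
- apply: (small_cover (f := f)) => //.
  by apply: small_sigma => // k; case: (PhiP k).
- have [q qP] := choice phif.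
  have [a aP] := fin [seq tag (q i) | i <- enum 'I_n]; exists a => i.
  rewrite -qP; apply/fP'; apply: ((PhiP _).2 _).1; apply: aP.
  by apply: (List.in_map (fun i => tag (q i))); apply: In_mem; rewrite mem_enum.
exists a => k; apply/(PhiP k).2 => k'.
by apply/(fP' (existT _ k k')); apply: aP; exists (existT _ k k').
Qed.

(** The defining formulas quantify [Y] over conjunctions of finite lists of [Phi]. Together they say
    that the conditions on [b] over [a] are finitely satisfiable, and saturation realises them. *)
Lemma tdef_ex X Y (P : assignment M (ctx_sum X Y) -> Prop) :
  tdef P -> tdef (fun a => exists b : assignment M Y, P (assign_sum a b)).
Proof.
move=> [K [Phi [smK PhiP]]].
(* Without assignments of [Y] the projection is empty; otherwise [b0] meets the side condition of
   [exists_formula]. *)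
have [[b0]|noY] := pselect (inhabited (assignment M Y)); last first.
  apply: (@eq_tdef X (sat (Bot X))); last exact: tdef_sat.
  by move=> a; split=> // -[b _]; apply: noY.
have [Psi PsiP] := choice (fun l : list K => exists_formula (conj [seq Phi k | k <- l])).
exists (list K), Psi; split; first exact: small_list.
move=> a; split=> [[b /PhiP abP] l|aP].
  apply: (PsiP l M a).1; exists b; apply/sat_conj => phi /List.in_map_iff[k [<- _]].
  exact: abP.
pose swap (z : var (ctx_sum X Y)) : term (ctx_sum Y X) (srt z) :=
  match z return term (ctx_sum Y X) (srt (c := ctx_sum X Y) z) with
  | inl x => @Var L (ctx_sum Y X) (inr x)
  | inr y => @Var L (ctx_sum Y X) (inl y)
  end.
have swapE (b : assignment M Y) :
    (fun z => eval (assign_sum b a) (swap z)) = assign_sum a b.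
  by apply: functional_extensionality_dep; case.
have [k||b bP] := @tdef_saturated Y X K
  (fun k c => sat (Phi k) (fun z => eval c (swap z))) a smK.
- exact/tdef_subst/tdef_sat.
- move=> l; have [b /sat_conj bP] := (PsiP l M a).2 b0 (aP l); exists b => k kl.
  by rewrite swapE; apply/bP/List.in_map.
by exists b; apply/PhiP => k; rewrite -swapE.
Qed.

End TypeDefinable.

(** * Hyperimaginary sorts *)

Lemma In_tnth (A : Type) (x : A) (l : list A) :
  List.In x l -> exists i, tnth (in_tuple l) i = x.
Proof.
move=> xl; suff [n nl <-] : exists2 n, n < size l & nth x l n = x.
  by exists (Ordinal nl); rewrite (tnth_nth x).
elim: l xl => //= y l IHl [->|/IHl[n nl nx]]; first by exists 0.
by exists n.+1.
Qed.

Section HyperimaginarySorts.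
Variables (sm : smallness) (L : signature) (M : structure L).
Variables (I : Type) (calE : I -> typedef_equiv sm M).
Hypothesis satM : small_saturated sm M.
Hypothesis smL : small_signature sm L.

Notation HL := (hsignature calE).
Notation HM := (hstructure calE).
Notation rctx1 := (real_ctx1 calE).

(** The analogue of [real_ctx] for contexts of any size. *)
Definition rctx (X : ctx (sort HL)) : ctx (sort L) :=
  Ctx (fun p : {x : var X & var (rctx1 (srt x))} => srt (tagged p)).

Definition cls1 (s : hsort L I) : assignment M (rctx1 s) -> hcarrier calE s :=
  match s return assignment M (rctx1 s) -> hcarrier calE s with
  | inl s0 => fun b => b tt
  | inr e => fun b => exist _ (typedef_rel (te_fml (t := calE e)) b) (ex_intro _ b erefl)
  end.

Definition cls (X : ctx (sort HL)) (b : assignment M (rctx X)) : assignment HM X :=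
  fun x => cls1 (fun y => b (existT _ x y)).

Lemma cls1_eq (e : I) (a b : assignment M (rctx1 (inr e))) :
  cls1 a = cls1 b <-> typedef_rel (te_fml (t := calE e)) a b.
Proof.
have [Er Es Et] := te_equiv (calE e); split=> [/(congr1 sval) /= ->|ab]; first exact: Er.
apply: eq_exist; apply: funext => c; apply: propext.
by split; apply: Et => //; apply: Es.
Qed.

Lemma represents1E s (b : assignment M (rctx1 s)) (c : hcarrier calE s) :
  represents1 b c <-> cls1 b = c.
Proof.
case: s b c => [s|e] b c //=; case: c => C [a Ca] /=.
rewrite (_ : exist _ C _ = @cls1 (inr e) a); last by apply: eq_exist.
rewrite Ca; have [Er Es Et] := te_equiv (calE e).
by split=> [/Es/cls1_eq|/(@cls1_eq e)/Es].
Qed.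

Lemma cls1_surj s (c : hcarrier calE s) : exists b : assignment M (rctx1 s), cls1 b = c.
Proof.
case: s c => [s|e] c; first by exists (fun=> c).
by case: c => C [a Ca]; exists a; apply: eq_exist.
Qed.

Lemma cls_surj X (c : assignment HM X) : exists b : assignment M (rctx X), cls b = c.
Proof.
have [b bP] := dep_choice (fun x => cls1_surj (c x)).
exists (fun p => b (tag p) (tagged p)).
exact: functional_extensionality_dep.
Qed.

(** On a real sort this is an equation. On a sort of classes it is [E] itself, a small set because
    the signature and the variables of [E] are small. *)
Lemma tdef_cls1_eq Z s (t u : forall y : var (rctx1 s), term Z (srt y)) :
  tdef sm (fun a : assignment M Z =>
    cls1 (fun y => eval a (t y)) = cls1 (fun y => eval a (u y))).
Proof.
pose sigma (z : var (ctx_sum (rctx1 s) (rctx1 s))) : term Z (srt z) :=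
  match z return term Z (srt (c := ctx_sum (rctx1 s) (rctx1 s)) z) with
  | inl y => t y
  | inr y => u y
  end.
apply: (@tdef_subst sm L M _ Z sigma (fun a =>
  cls1 (fun y => a (inl y)) = cls1 (fun y => a (inr y)))).
case: s t u {sigma} => [s|e] _ _.
  pose Y := ctx_sum (rctx1 (inl s)) (rctx1 (inl s)).
  exact: (tdef_sat sm M (@Eq L Y s (@Var L Y (inl tt)) (@Var L Y (inr tt)))).
pose Y := ctx_sum (rctx1 (inr e)) (rctx1 (inr e)).
exists {phi : formula Y | te_fml phi}, sval; split.
  by apply/small_sub/small_formula => //; apply: small_sum; apply: te_small.
move=> a; rewrite cls1_eq.
have aE : assign_sum (fun y : var (rctx1 (inr e)) => a (inl y)) (fun y => a (inr y)) = a.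
  by apply: functional_extensionality_dep; case.
split=> [aP [phi phiP]|aP phi phiP].
  by have := aP phi phiP; rewrite aE.
by rewrite aE; apply: (aP (exist _ phi phiP)).
Qed.

(** Function symbols have real values, so a term of a class sort is a variable. *)
Lemma real_term X s (t : term (L := HL) X s) :
  exists tau : forall y : var (rctx1 s), term (rctx X) (srt y),
    forall b : assignment M (rctx X), eval (cls b) t = cls1 (fun y => eval b (tau y)).
Proof.
elim: t => [x|f t /dep_choice[tau tauP]].
  by exists (fun y => @Var L (rctx X) (existT _ x y)).
exists (fun _ : unit => @App L (rctx X) f (fun i => tau i tt)) => b /=.
by congr fint; apply: functional_extensionality_dep => i; rewrite tauP.
Qed.

Lemma small_ord n : sm 'I_n.
Proof. exact: small_inj val_inj (small_nat sm). Qed.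

(** Quantifying over classes, and over the representatives hidden in [R_phi], becomes quantifying
    over real tuples; [tdef_ex] absorbs both. *)
Lemma tdef_real X (phi : formula (L := HL) X) :
  tdef sm (fun b : assignment M (rctx X) => sat phi (cls b)).
Proof.
elim: phi => {X} [X s t u|X r t|X|X|X phi IHphi psi IHpsi|X phi IHphi psi IHpsi|X s phi IHphi] /=.
- have [tau tauP] := real_term t; have [ups upsP] := real_term u.
  apply: eq_tdef (tdef_cls1_eq tau ups) => b.
  by rewrite tauP upsP.
- have [tau tauP] := dep_choice (fun i => real_term (t i)).
  case: r t tau tauP => [r|r] t tau tauP.
    apply: eq_tdef (tdef_sat sm M (@Rel L (rctx X) r (fun i => tau i tt))) => b /=.
    by rewrite (_ : (fun i => _) = (fun i => eval (cls b) (t i))) //;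
      apply: functional_extensionality_dep => i; rewrite tauP.
  pose Y := real_ctx calE (hr_srt (h := r)); pose Z := ctx_sum (rctx X) Y.
  have Pd : tdef sm (fun c : assignment M Z =>
      (forall i, cls1 (fun y => c (inr (existT _ i y))) =
        cls1 (fun y => eval (fun x => c (inl x)) (tau i y))) /\
      sat (hr_fml r) (fun y => c (inr y))).
    apply: tdef_and.
      apply: tdef_all (small_ord _) _ => i.
      pose t1 y := @Var L Z (inr (existT (fun j => var (rctx1 (hr_srt j))) i y)).
      pose t2 y := term_subst (fun x => @Var L Z (inl x)) (tau i y).
      apply: eq_tdef (tdef_cls1_eq t1 t2) => c /=.
      by rewrite (_ : (fun y => eval c (t2 y)) = (fun y => eval (fun x => c (inl x)) (tau i y))) //;
        apply: functional_extensionality_dep => y; rewrite eval_subst.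
    exact: tdef_subst (fun y => @Var L Z (inr y)) _ (tdef_sat sm M (hr_fml r)).
  apply: eq_tdef (tdef_ex satM Pd) => b /=; split=> [[b' [cb' rb']]|[b' cb' rb']]; exists b' => //.
    by move=> i; apply/represents1E; rewrite tauP; apply: cb'.
  by split=> // i; move/represents1E: (cb' i); rewrite tauP.
- exact: tdef_sat (Top _).
- exact: tdef_sat (Bot _).
- exact: tdef_and.
- exact: tdef_or.
- pose Z := ctx_sum (rctx X) (rctx1 s).
  pose sigma (p : var (rctx (ctx_ext X s))) : term Z (srt p) :=
    let: existT o y := p in
    match o return forall y : var (rctx1 (srt (c := ctx_ext X s) o)), term Z (srt y) with
    | Some x => fun y => @Var L Z (inl (existT _ x y))
    | None => fun y => @Var L Z (inr y)
    end y.
  apply: eq_tdef (tdef_ex satM (tdef_subst sigma IHphi)) => b /=.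
  have ext (b' : assignment M (rctx1 s)) :
      cls (fun p => eval (assign_sum b b') (sigma p)) = assign_ext (cls b) (cls1 b' : HM s).
    by apply: functional_extensionality_dep; case.
  split=> [[b' b'P]|[m mP]]; first by exists (cls1 b'); rewrite -ext.
  by have [b' b'm] := cls1_surj m; exists b'; rewrite ext b'm.
Qed.

(** [theta] is one symbol [R_psi'] applied to the variables of [X] whose representatives occur in
    [psi]; the remaining classes may be represented arbitrarily. *)
Lemma some_representative X (psi : formula (rctx X)) :
  exists theta : formula (L := HL) X, forall c : assignment HM X,
    sat theta c <-> exists2 b : assignment M (rctx X), cls b = c & sat psi b.
Proof.
have [l lP] := formula_support psi.
pose xs := [seq tag p | p <- l]; pose s i : hsort L I := srt (tnth (in_tuple xs) i).
pose Y := real_ctx calE s.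
pose restr (b : assignment M (rctx X)) : assignment M Y :=
  fun p => b (existT _ (tnth (in_tuple xs) (tag p)) (tagged p)).
(* [xs] may list [x] several times, giving independent representatives of one class; [tau] fixes one
   position and reads only that copy. *)
have tauP x : exists tau : List.In x xs -> forall y : var (rctx1 (srt x)), term Y (srt y),
   forall (xl : List.In x xs),
    (forall b' c, represents (s := s) b' (fun i => c (tnth (in_tuple xs) i)) ->
      cls1 (fun y => eval b' (tau xl y)) = c x) /\
    (forall (b : assignment M (rctx X)) y, eval (restr b) (tau xl y) = b (existT _ x y)).
  have [xl|noti] := pselect (List.In x xs); last first.
    by exists (fun xl => False_rect _ (noti xl)) => xl; case: (noti xl).
  have [i ix] := In_tnth xl; case: _ / ix.
  exists (fun _ y => @Var L Y (existT (fun j => var (rctx1 (s j))) i y)) => _; split=> // b' c cb'.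
  exact/represents1E/cb'.
have [tau {}tauP] := dep_choice tauP.
pose sigma : @partial_subst L (rctx X) Y l := fun p pl =>
  tau (tag p) (List.in_map _ l p pl) (tagged p).
have [psi' psi'P] := lP Y sigma.
exists (@Rel HL X (inr (HRel psi')) (fun i => @Var HL X (tnth (in_tuple xs) i))) => c /=.
split=> [[b' cb' b'psi]|[b cb bpsi]]; last first.
  exists (restr b); first by move=> i; apply/represents1E; rewrite -cb.
  by apply/(psi'P M b) => // -[x y] pl; apply: (tauP _ _).2.
have /dep_choice[b bP] x : exists b : assignment M (rctx1 (srt x)), cls1 b = c x /\
    forall (xl : List.In x xs) y, b y = eval b' (tau x xl y).
  have [xl|noti] := pselect (List.In x xs).
    exists (fun y => eval b' (tau x xl y)); split; first exact: (tauP _ _).1.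
    by move=> xl' y; rewrite (Prop_irrelevance xl' xl).
  by have [b bc] := cls1_surj (c x); exists b; split=> // xl; case: (noti xl).
exists (fun p => b (tag p) (tagged p)).
  by apply: functional_extensionality_dep => x; apply: (bP x).1.
by apply/(psi'P M _ b') => // -[x y] pl; rewrite -(bP x).2.
Qed.

(** * Positive closedness, saturation and homogeneity *)

Section Monster.
Variable T : theory L.
Hypothesis pcM : pc_model T M.
Hypothesis homM : small_homogeneous sm M.

Lemma hstructure_pc : pc_model (htheory calE) HM.
Proof.
split=> // N h TN hom X phi a hphi; apply: contrapT => aphi.
have [b ba] := cls_surj a.
have [K [Phi [_ PhiP]]] := tdef_real phi.
have [k kP] : exists k, ~ sat (Phi k) b.
  by apply/existsNP => bPhi; apply: aphi; rewrite -ba; apply/PhiP.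
have [psi bpsi incomp] := pc_incompatible pcM kP.
have [theta thetaP] := some_representative psi.
(* In [N] the image of [a] satisfies both [theta] and [phi]. Transferred back, some tuple [c] does
   too, so a representative [d] satisfies [psi] as well as [Phi k]. *)
have [|c [/thetaP[d dc dpsi] cphi]] :=
  @satisfiable_transfer HL HM N X (And theta phi) (fun x => h _ (a x)) TN.
  by split=> //; apply/hom/thetaP; exists b.
by apply: (incomp d dpsi); move: k {kP incomp}; apply/PhiP; rewrite dc.
Qed.

Lemma hstructure_saturated : small_saturated sm HM.
Proof.
move=> X Phi smPhi fin.
pose Z := ctx_sum (rctx X) (rctx (params HM)).
pose sigma (p : var (rctx (ctx_sum X (params HM)))) : term Z (srt p) :=
  let: existT z y := p in
  match z return forall y : var (rctx1 (srt (c := ctx_sum X (params HM)) z)), term Z (srt y) with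
  | inl x => fun y => @Var L Z (inl (existT _ x y))
  | inr x => fun y => @Var L Z (inr (existT _ x y))
  end y.
(* Fixing a representative of every element turns all parameters into real ones. *)
have [d dP] := cls_surj (@self_assignment HL HM).
have clsE (b : assignment M (rctx X)) :
    cls (fun p => eval (assign_sum b d) (sigma p)) = assign_sum (cls b) (@self_assignment HL HM).
  by rewrite -dP; apply: functional_extensionality_dep; case.
have [q||b bP] := @tdef_saturated sm L M satM (rctx X) (rctx (params HM)) {phi | Phi phi}
  (fun q c => sat (sval q) (cls (fun p => eval c (sigma p)))) d smPhi.
- exact: (tdef_subst sigma (tdef_real (sval q))).
- move=> l; have [|a aP] := fin (size l) (fun i => sval (tnth (in_tuple l) i)).
    by move=> i; apply: svalP.
  have [b ba] := cls_surj a; exists b => q ql.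
  by have [i <-] := In_tnth ql; rewrite clsE ba; apply: aP.
exists (cls b) => phi Phiphi; rewrite /sat_params.
by have := bP (exist _ phi Phiphi); rewrite clsE.
Qed.

Definition lift_map (sigma : forall s, M s -> M s) (s : sort HL) (c : HM s) : HM s :=
  cls1 (fun y => sigma _ (sval (cid (cls1_surj c)) y)).

(** The chosen representative and [b] are equivalent, and [sigma] preserves the positive formulas
    making up [E]. *)
Lemma lift_map_cls1 (sigma : forall s, M s -> M s) s (b : assignment M (rctx1 s)) :
  homomorphism sigma -> lift_map sigma (cls1 b) = cls1 (fun y => sigma _ (b y)).
Proof.
move=> hom; rewrite /lift_map; case: (cid _) => d /=.
case: s b d => [s|e] b d; first by move=> /= ->.
move=> /cls1_eq db; apply/cls1_eq => phi phiE.
rewrite (_ : assign_sum _ _ = (fun z => sigma _ (assign_sum d b z))).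
  exact/hom/db.
by apply: functional_extensionality_dep; case.
Qed.

Lemma lift_map_cls (sigma : forall s, M s -> M s) X (b : assignment M (rctx X)) :
  homomorphism sigma ->
  (fun x => lift_map sigma (cls b x)) = cls (fun p => sigma _ (b p)).
Proof.
by move=> hom; apply: functional_extensionality_dep => x; apply: lift_map_cls1.
Qed.

Lemma lift_map_homomorphism (sigma : forall s, M s -> M s) :
  homomorphism sigma -> homomorphism (M := HM) (N := HM) (lift_map sigma).
Proof.
move=> hom X phi a; have [b <-] := cls_surj a.
have [K [Phi [_ PhiP]]] := tdef_real phi.
by move=> /PhiP bPhi; rewrite lift_map_cls //; apply/PhiP => k; apply/hom/bPhi.
Qed.

Lemma lift_map_cancel (sigma tau : forall s, M s -> M s) :
  homomorphism sigma -> homomorphism tau -> (forall s, cancel (sigma s) (tau s)) ->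
  forall s, cancel (@lift_map sigma s) (@lift_map tau s).
Proof.
move=> hs ht st s c; have [b <-] := cls1_surj c.
rewrite !lift_map_cls1 //; congr cls1.
by apply: functional_extensionality_dep => y; rewrite st.
Qed.

Lemma hstructure_homogeneous : small_homogeneous sm HM.
Proof.
move=> X a b smX ab; have [a' a'a] := cls_surj a; have [b' b'b] := cls_surj b.
have smR : sm (var (rctx X)).
  apply: small_sigma => // x; case: (srt x) => [s|e]; first exact: small_unit.
  exact: te_small.
(* Conditions on the left half [d], with [b'] on the right: [d] represents [b], and it satisfies
   every formula true of [a']. *)
pose P k (c : assignment M (ctx_sum (rctx X) (rctx X))) : Prop :=
  match k with
  | inl x => cls1 (fun y => c (inl (existT _ x y))) = cls1 (fun y => c (inr (existT _ x y)))
  | inr q => sat (sval (q : {psi : formula (rctx X) | sat psi a'})) (fun p => c (inl p))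
  end.
have [||l|d dP] := @tdef_saturated sm L M satM _ _ _ P b'.
- exact/small_sum/small_sub/small_formula.
- case=> [x|q] /=.
    exact: (tdef_cls1_eq
      (fun y => @Var L (ctx_sum (rctx X) (rctx X)) (inl (existT _ x y)))
      (fun y => @Var L (ctx_sum (rctx X) (rctx X)) (inr (existT _ x y)))).
  exact: (tdef_subst (fun p => @Var L (ctx_sum (rctx X) (rctx X)) (inl p))
    (tdef_sat sm M (sval q))).
- pose qs := pmap (fun k => if k is inr q then Some (sval q) else None) l.
  (* [theta] holds at [a] through [a'], hence at [b]: some representative of [b] meets the finitely
     many conditions. *)
  have [theta thetaP] := some_representative (conj qs).
  have /ab/thetaP[d db /sat_conj dP] : sat theta a.
    apply/thetaP; exists a' => //; apply/sat_conj => psi.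
    rewrite /qs; elim: l {qs theta thetaP} => //= -[x|q] l IHl //= [<-|//].
    exact: (svalP q).
  exists d => -[x _|q ql] /=; first by move: (congr1 (fun c => c x) (etrans db (esym b'b))).
  apply: dP; rewrite /qs; elim: l ql {qs theta thetaP} => //= k l IHl [->|/IHl]; first by left.
  by case: k => // q' ql; right.
have da : forall psi : formula (rctx X), sat psi a' <-> sat psi d.
  by apply: (pc_type_maximal pcM) => psi psia; apply: (dP (inr (exist _ psi psia))).
have [sigma [hs [tau [ht st ts]]] sa] := homM smR da.
exists (lift_map sigma); last first.
  move=> x; rewrite -a'a -b'b; have := congr1 (fun c => c x) (lift_map_cls a' hs).
  move=> /= ->; apply: etrans (dP (inl x)); congr cls1.
  by apply: functional_extensionality_dep => y; apply: (sa (existT _ x y)).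
split; first exact: lift_map_homomorphism.
exists (lift_map tau); split; first exact: lift_map_homomorphism.
  exact: lift_map_cancel.
exact: lift_map_cancel.
Qed.

End Monster.
End HyperimaginarySorts.

Theorem theorem7p15 (sm : smallness) (L : signature) (T : theory L)
    (M : structure L) (I : Type) (calE : I -> typedef_equiv sm M) :
  small_signature sm L ->
  JCP T ->
  monster sm T M ->
  monster sm (htheory calE) (hstructure calE).
Proof.
move=> smL _ [_ pcM satM homM]; split.
(* Models of [htheory calE] are the structures to which [hstructure calE] transfers its h-inductive
   sentences. *)
- by move=> A B; apply: joint_continuation.
- exact: hstructure_pc pcM.
- exact: hstructure_saturated.
- exact: hstructure_homogeneous pcM homM.
Qed.
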